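(* Let $N\ge 2$ be an integer and $p_N(x)=1-ax-bx^N$, with $a,b$ indeterminates. Then \[ \frac{1}{p_N(x)}*\frac{1}{p_N(x)}=\frac{f_{N-1}(x;a,b)}{p_N(\sqrt{x})\,p_N(-\sqrt{x})\,f_{N-1}(x;a,-b)}, \] where $*$ is the Hadamard product.
   Context: For formal power series $A(x)=\sum_n a_nx^n$, $B(x)=\sum_n b_nx^n$, the Hadamard product is $A(x)*B(x)=\sum_n a_nb_nx^n$. For a positive integer $M$ define \[ f_M(x;a,b)=\sum_{s=0}^{M(M+1)/2} c_s(M)\,a^{\mathrm{rem}(2s,M+1)}\,b^{\lfloor 2s/(M+1)\rfloor}x^s, \] where $\mathrm{rem}(2s,M+1)$ is the remainder of $2s$ upon division by $M+1$, and, writing $q_j,r_j$ for the quotient and remainder of $s$ upon division by $M+j$ ($j\in\{0,1\}$), \[ c_s(M)=\begin{cases}1 & s=0,\\ (-1)^{q_1+1}\binom{M-r_1}{q_1}\binom{q_1+r_1-\lfloor M/2\rfloor-1}{q_1} & \lfloor 2s/(M+1)\rfloor\text{ odd and } r_1>\lfloor M/2\rfloor,\\ (-1)^{q_0}\binom{r_0-1}{q_0-1}\binom{\lfloor M/2\rfloor-r_0+q_0}{q_0} & \lfloor 2s/(M+1)\rfloor\text{ even and } r_0\le\lfloor M/2\rfloor,\\ 0 & \text{otherwise.}\end{cases} \] Binomial coefficients $\binom{n}{j}$ are $0$ when $j<0$ or when $n$ or $j$ is not an integer. *)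

(* Defs.v *)
From mathcomp Require Import all_boot all_order all_algebra.
From mathcomp Require Import ring.
From mathcomp Require Export mpoly.

Set Implicit Arguments.
Unset Strict Implicit.
Unset Printing Implicit Defensive.

Import Order.TTheory GRing.Theory Num.Theory.
Local Open Scope ring_scope.

(* A formal power series is its coefficient sequence; equality of series is
   pointwise equality [=1]. *)
Definition fps (R : Type) := nat -> R.

Section PowerSeries.
Variable R : comUnitRingType.
Implicit Types (A B : fps R) (p q : {poly R}).

Definition fps_mul A B : fps R :=
  fun n => \sum_(i < n.+1) A i * B (n - i)%N.

Definition fps_of_poly p : fps R := fun n => p`_n.

(* [fps_inv_seq A n] lists the first n coefficients of 1/A; the recursion
   solves (A * B)_m = [m = 0] for B_m, so it is meaningful only when A 0 is a
   unit (see [fps_mulV]). *)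
Fixpoint fps_inv_seq A (n : nat) : seq R :=
  if n is m.+1 then
    let s := fps_inv_seq A m in
    rcons s ((A 0%N)^-1 * ((m == 0%N)%:R - \sum_(i < m) s`_i * A (m - i)%N))
  else [::].

Definition fps_inv A : fps R := fun n => (fps_inv_seq A n.+1)`_n.

Definition fps_div A B : fps R := fps_mul A (fps_inv B).

Definition hadamard A B : fps R := fun n => A n * B n.

(* The image of A(x) under x |-> t^2, i.e. A seen as a series in t = sqrt x. *)
Definition fps_sqrt_var A : fps R := fun n => if odd n then 0 else A n./2.

Lemma size_fps_inv_seq A n : size (fps_inv_seq A n) = n.
Proof. by elim: n => //= n IHn; rewrite size_rcons IHn. Qed.

Lemma nth_fps_inv_seq A n i : (i < n)%N -> (fps_inv_seq A n)`_i = fps_inv A i.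
Proof.
elim: n => // n IHn; rewrite ltnS leq_eqVlt => /predU1P[-> // | lt_in].
by rewrite /= nth_rcons size_fps_inv_seq lt_in IHn.
Qed.

Lemma fps_mulV A : A 0%N \is a GRing.unit ->
  fps_mul (fps_inv A) A =1 fps_of_poly 1.
Proof.
move=> uA n; rewrite /fps_mul big_ord_recr /= subnn.
rewrite {2}/fps_inv /= nth_rcons size_fps_inv_seq ltnn eqxx /fps_of_poly coef1.
under [X in _ * (_ - X)]eq_bigr => i _ do rewrite nth_fps_inv_seq ?ltn_ord //.
by rewrite mulrAC mulVr // mul1r addrC subrK.
Qed.

End PowerSeries.

(* Binomial coefficients with integer arguments: 0 for a negative lower index,
   and C(-(m+1), k) = (-1)^k C(m+k, k) for a negative upper one
   (see [binzE]). *)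
Definition binz (n j : int) : int :=
  match j, n with
  | Negz _, _ => 0
  | Posz k, Posz m => 'C(m, k)%:Z
  | Posz k, Negz m => (-1) ^+ k * 'C(m + k, k)%:Z
  end.

Lemma binzE (n : int) (k : nat) :
  binz n k * k`!%:Z = \prod_(i < k) (n - i%:Z).
Proof.
case: n => m /=.
  rewrite -PoszM bin_ffact.
  elim: k => [|k IHk]; first by rewrite big_ord0 ffactn0.
  rewrite big_ord_recr /= -IHk ffactnSr PoszM.
  case: (leqP k m) => [le_km | lt_mk]; first by rewrite subzn.
  by rewrite ffact_small // !mul0r.
elim: k => [|k IHk]; first by rewrite big_ord0 addn0 bin0.
rewrite big_ord_recr /= -IHk factS PoszM NegzE -opprD -PoszD addSn.
have /(congr1 Posz): (k.+1 * 'C(m + k.+1, k.+1) = (m + k).+1 * 'C(m + k, k))%N.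
  by rewrite addnS -mul_bin_diag.
rewrite !PoszM exprS => E.
rewrite mulrA -[_ * k.+1%:Z]mulrA [_ * k.+1%:Z]mulrC E.
by ring.
Qed.

Definition coef_c (M s : nat) : int :=
  let h := (M./2)%:Z in
  let q0 := (s %/ M)%N in let r0 := (s %% M)%N in
  let q1 := (s %/ M.+1)%N in let r1 := (s %% M.+1)%N in
  let d := (s.*2 %/ M.+1)%N in
  if s == 0%N then 1
  else if odd d && (M./2 < r1)%N then
    (-1) ^+ q1.+1 * binz (M%:Z - r1%:Z) q1 * binz (q1%:Z + r1%:Z - h - 1) q1
  else if ~~ odd d && (r0 <= M./2)%N then
    (-1) ^+ q0 * binz (r0%:Z - 1) (q0%:Z - 1) * binz (h - r0%:Z + q0%:Z) q0
  else 0.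

Definition poly_f (R : comNzRingType) (M : nat) (a b : R) : {poly R} :=
  \poly_(s < (M * M.+1 %/ 2).+1)
    ((coef_c M s)%:~R * a ^+ (s.*2 %% M.+1) * b ^+ (s.*2 %/ M.+1)).

Definition poly_p (R : comNzRingType) (N : nat) (a b : R) : {poly R} :=
  1 - a *: 'X - b *: 'X^N.

(* All the divisions in the statement are by series with constant term 1. *)
Lemma poly_p0 (R : comNzRingType) N (a b : R) :
  (0 < N)%N -> (poly_p N a b)`_0 = 1.
Proof.
by case: N => // N _; rewrite !coefB coef1 !coefZ coefX coefXn !mulr0 !subr0.
Qed.

Lemma denominator0 (R : comNzRingType) N (a b : R) : (0 < N)%N ->
  (poly_p N a b * (poly_p N a b \Po - 'X) * (poly_f N.-1 a (- b) \Po 'X^2))`_0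
    = 1.
Proof.
move=> N_gt0; rewrite -horner_coef0 !hornerM !horner_comp hornerN hornerX hornerXn.
rewrite expr0n oppr0 !horner_coef0 poly_p0 // coef_poly /= mod0n div0n !expr0.
by rewrite /coef_c /= !mulr1.
Qed.

(* Main.v *)
Require Import Defs.
From mathcomp Require Import all_boot all_order all_algebra.
From mathcomp Require Import ring zify.
Import GRing.Theory.
Local Open Scope ring_scope.

(* Write t = sqrt x, A = a t, B = b t^N, let u_n be the coefficients of 1/p_N,
   and put g_k = \sum_n u_n u_(n+k) t^(2n+k), so that g_0 is the Hadamard square.
   The recurrence of u gives the reflected system
     g_k = A g_(k-1) + B g_(N-k) (0 < k <= N),   g_0 = 1 + A g_1 + B g_N.
   Starting from the middle index and moving outwards, the pairs (g_k, g_(N-k))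
   are transported by a 2x2 matrix of determinant 1, hence are given by a
   Chebyshev-like pair (E_n, F_n) of polynomials in A^2 and B^2.  Solving for
   g_0 yields A^m D f(-B) g_0 = A^m f(B), where m = N/2, D is
   p_N(t) p_N(-t), and f(B) is E_m - B F_m for even N, E_(m+1) - A B F_m for odd N.
   The coefficients of E_n and F_n are products of two binomials, and f is
   recognised as f_(N-1) on splitting s according to its quotient and remainder
   modulo N.  Power series are handled modulo t^(L+1). *)

(** * The reflected recurrence *)

(** One step has trace 1 + x - y and determinant x. With x = A^2 and y = B^2 these are the trace and
    determinant of the transfer of (g_(m-j), g_(m+j)) scaled by [A], so that nothing is divided by
    [A]. *)
Fixpoint cheb (S : comNzRingType) (x y : S) (n : nat) : S * S :=
  if n is m.+1 then
    let e := (cheb S x y m).1 - y * (cheb S x y m).2 in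
    (e, e + x * (cheb S x y m).2)
  else (1, 0).
Arguments cheb {S} x y n.

Section Reflection.
Variables (S : comNzRingType) (A B : S).
Local Notation E n := (cheb (A ^+ 2) (B ^+ 2) n).1.
Local Notation F n := (cheb (A ^+ 2) (B ^+ 2) n).2.

(** Each outward step solves the recurrence at m - j for [g (m - j.+1)], multiplying by [A] instead
    of dividing. Then A^m g_0 and, through the equation for [g 0], A^m itself are multiples of the
    middle value [g m]; cross-multiplying gives the claim. The factor (1 - B)^2 - A^2 is (1 - A -
    B)(1 + A - B). *)
Lemma reflection_even (m : nat) (g : nat -> S) : (0 < m)%N ->
    (forall k, (0 < k <= m.*2)%N -> g k = A * g k.-1 + B * g (m.*2 - k)%N) ->
    g 0%N = 1 + A * g 1%N + B * g m.*2 ->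
  A ^+ m * (((1 - B) ^+ 2 - A ^+ 2) * (E m + B * F m) * g 0%N)
    = A ^+ m * (E m - B * F m).
Proof.
move=> m_gt0 g_rec g0.
have gP j : (j <= m)%N ->
    A ^+ j * g (m - j)%N = (E j - B * F j) * g m
    /\ A ^+ j * g (m + j)%N = (E j + (A ^+ 2 - 1 + B - B ^+ 2) * F j) * g m.
  elim: j => [|j IHj] lt_jm.
    by rewrite subn0 addn0 /= expr0 mulr0 subr0 mulr0 addr0.
  have [IH1 IH2] := IHj (ltnW lt_jm).
  have ge1 : g (m - j)%N = A * g (m - j.+1)%N + B * g (m + j)%N.
    by rewrite g_rec; [congr (_ * g _ + _ * g _)|]; lia.
  have ge2 : g (m + j.+1)%N = A * g (m + j)%N + B * g (m - j.+1)%N.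
    by rewrite g_rec; [congr (_ * g _ + _ * g _)|]; lia.
  have H1 : A ^+ j.+1 * g (m - j.+1)%N = (E j.+1 - B * F j.+1) * g m.
    have -> : A ^+ j.+1 * g (m - j.+1)%N
        = A ^+ j * g (m - j)%N - B * (A ^+ j * g (m + j)%N).
      by rewrite ge1 exprS; ring.
    by rewrite IH1 IH2 /=; ring.
  split=> //; rewrite ge2.
  have -> : A ^+ j.+1 * (A * g (m + j)%N + B * g (m - j.+1)%N)
      = A ^+ 2 * (A ^+ j * g (m + j)%N) + B * (A ^+ j.+1 * g (m - j.+1)%N).
    by rewrite exprS; ring.
  by rewrite H1 IH2 /=; ring.
case: m m_gt0 g_rec g0 gP => // n _ _ g0 gP.
have [H0 HN] := gP n.+1 (leqnn _).
have [H1 _] := gP n (leqnSn _).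
rewrite subnn in H0; rewrite subSnn in H1; rewrite addnn in HN.
have Hg : A ^+ n.+1 = ((1 - B) ^+ 2 - A ^+ 2) * (E n.+1 + B * F n.+1) * g n.+1.
  have -> : A ^+ n.+1 = A ^+ n.+1 * g 0%N - A ^+ 2 * (A ^+ n * g 1%N)
                        - B * (A ^+ n.+1 * g n.+1.*2).
    by rewrite g0 exprS; ring.
  by rewrite H0 H1 HN /=; ring.
rewrite mulrCA H0 [in RHS]Hg; ring.
Qed.

(** The axis of reflection now lies between m and m + 1. Since g_(m+1) = (A + B) g_m, the single
    value [g m] still determines the pairs (g_(m-j), g_(m+j+1)), and the even argument carries
    over. *)
Lemma reflection_odd (m : nat) (g : nat -> S) : (0 < m)%N ->
    (forall k, (0 < k <= m.*2.+1)%N ->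
       g k = A * g k.-1 + B * g (m.*2.+1 - k)%N) ->
    g 0%N = 1 + A * g 1%N + B * g m.*2.+1 ->
  A ^+ m * ((1 - (A + B) ^+ 2) * (E m.+1 + A * B * F m) * g 0%N)
    = A ^+ m * (E m.+1 - A * B * F m).
Proof.
move=> m_gt0 g_rec g0.
have gP j : (j <= m)%N ->
    A ^+ j * g (m - j)%N = (E j.+1 - A * B * F j) * g m
    /\ A ^+ j * g (m + j.+1)%N = ((A + B) * F j.+1 - A * F j) * g m.
  elim: j => [|j IHj] lt_jm.
    have ge : g (m + 1)%N = A * g m + B * g m.
      by rewrite g_rec; [congr (_ * g _ + _ * g _)|]; lia.
    by rewrite subn0 ge /=; split; ring.
  have [IH1 IH2] := IHj (ltnW lt_jm).
  have ge1 : g (m - j)%N = A * g (m - j.+1)%N + B * g (m + j.+1)%N.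
    by rewrite g_rec; [congr (_ * g _ + _ * g _)|]; lia.
  have ge2 : g (m + j.+2)%N = A * g (m + j.+1)%N + B * g (m - j.+1)%N.
    by rewrite g_rec; [congr (_ * g _ + _ * g _)|]; lia.
  have H1 : A ^+ j.+1 * g (m - j.+1)%N = (E j.+2 - A * B * F j.+1) * g m.
    have -> : A ^+ j.+1 * g (m - j.+1)%N
        = A ^+ j * g (m - j)%N - B * (A ^+ j * g (m + j.+1)%N).
      by rewrite ge1 exprS; ring.
    by rewrite IH1 IH2 /=; ring.
  split=> //; rewrite ge2.
  have -> : A ^+ j.+1 * (A * g (m + j.+1)%N + B * g (m - j.+1)%N)
      = A ^+ 2 * (A ^+ j * g (m + j.+1)%N) + B * (A ^+ j.+1 * g (m - j.+1)%N).
    by rewrite exprS; ring.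
  by rewrite H1 IH2 /=; ring.
case: m m_gt0 g_rec g0 gP => // n _ _ g0 gP.
have [H0 HN] := gP n.+1 (leqnn _).
have [H1 _] := gP n (leqnSn _).
rewrite subnn in H0; rewrite subSnn in H1; rewrite addnS addnn in HN.
have Hg : A ^+ n.+1 = (1 - (A + B) ^+ 2) * (E n.+2 + A * B * F n.+1) * g n.+1.
  have -> : A ^+ n.+1 = A ^+ n.+1 * g 0%N - A ^+ 2 * (A ^+ n * g 1%N)
                        - B * (A ^+ n.+1 * g n.+1.*2.+1).
    by rewrite g0 exprS; ring.
  by rewrite H0 H1 HN /=; ring.
rewrite mulrCA H0 [in RHS]Hg; ring.
Qed.

End Reflection.

(** * Coefficients of f *)

(* 'C(i + q - 1, q - 1), read as [i = 0] when q = 0. *)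
Definition bin_pred (i q : nat) : nat :=
  if q is q'.+1 then 'C(i + q', q')%N else (i == 0%N).

Section ClosedForm.
Variables (S : comNzRingType) (x y : S).

Definition cheb1_coef (n i q : nat) : S :=
  (-1) ^+ q * ('C(n - i.+1, q) * bin_pred i q)%:R.
Definition cheb2_coef (n i q : nat) : S :=
  (-1) ^+ q * ('C(n - i.+1, q) * 'C(i + q, q))%:R.

(** Both inductive steps are Pascal's rule. The first component is stated at n + 1 because an empty
    sum would miss its value 1 at 0. The bound Q is free, so that both sums can later be cut at the
    same q. *)
Lemma cheb_closed_form n :
  (forall Q, (n < Q)%N -> (cheb x y n.+1).1 =
     \sum_(i < n.+1) \sum_(q < Q) cheb1_coef n.+1 i q * x ^+ i * y ^+ q)
  /\ (forall Q, (n <= Q)%N -> (cheb x y n).2 =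
     \sum_(i < n) \sum_(q < Q) cheb2_coef n i q * x ^+ i * y ^+ q).
Proof.
elim: n => [|n [IHE IHF]].
  split=> [[|Q] // _|Q _]; last by rewrite big_ord0.
  rewrite big_ord1 big_ord_recl big1 => [|q _].
    by rewrite /= /cheb1_coef /= !expr0 !mulr1 mulr0 subr0 addr0.
  by rewrite /cheb1_coef /= bin0n !(mul0n, mulr0, mul0r).
have F_S Q : (n < Q)%N -> (cheb x y n.+1).2 =
    \sum_(i < n.+1) \sum_(q < Q) cheb2_coef n.+1 i q * x ^+ i * y ^+ q.
  move=> lt_nQ.
  have -> : (cheb x y n.+1).2 = (cheb x y n.+1).1 + x * (cheb x y n).2 by [].
  rewrite (IHE Q) // (IHF Q) ?(ltnW lt_nQ) //.
  rewrite !(big_ord_recl n) -addrA; congr (_ + _).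
    apply: eq_bigr => q _; rewrite /cheb1_coef /cheb2_coef /=.
    by case: (val q) => [|j]; rewrite /= ?bin0 // !add0n !binn.
  rewrite mulr_sumr -big_split; apply: eq_bigr => i _.
  rewrite mulr_sumr -big_split; apply: eq_bigr => q _ /=.
  rewrite /cheb1_coef /cheb2_coef /bump leq0n add1n subSS.
  have -> : 'C(i.+1 + q, q) = (bin_pred i.+1 q + 'C(i + q, q))%N.
    case: (val q) => [|j]; first by rewrite !bin0.
    by rewrite /= !addnS !addSn binS addnC.
  by rewrite mulnDr natrD exprS; ring.
split=> // -[//|Q]; rewrite ltnS => lt_nQ.
have -> : (cheb x y n.+2).1 = (cheb x y n.+1).1 - y * (cheb x y n.+1).2 by [].
rewrite (IHE Q.+1) ?ltnS 1?ltnW // (F_S Q) //.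
(* The top index i = n + 1 contributes nothing: [bin_pred] vanishes for q = 0, and 'C(0, q) for q >
   0. *)
rewrite [RHS]big_ord_recr /= [X in _ = _ + X]big1 ?addr0; last first.
  move=> q _; rewrite /cheb1_coef subnn bin0n.
  by case: (val q) => [|j] /=; rewrite !(mul0n, muln0, mulr0, mul0r).
rewrite mulr_sumr -sumrN -big_split; apply: eq_bigr => i _ /=.
rewrite !big_ord_recl /= -addrA; congr (_ + _).
  by rewrite /cheb1_coef /= !bin0.
rewrite mulr_sumr -sumrN -big_split; apply: eq_bigr => q _ /=.
rewrite /cheb1_coef /cheb2_coef /bump leq0n add1n /=.
rewrite !subSS (subSn (ltnSE (ltn_ord i))) binS mulnDl natrD !exprS; ring.
Qed.

End ClosedForm.

(** Since q (M + 1) + r = q M + (q + r), division by M has the same quotient q and remainder q + r;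
    and 2r <= M makes the exponent of b the even number 2q. *)
Lemma coef_c_low (M q r : nat) : (r <= M./2)%N -> (q + r < M)%N ->
  coef_c M (q * M.+1 + r) = (-1) ^+ q * ('C(M./2 - r, q) * bin_pred r q)%:Z.
Proof.
move=> le_rh lt_qrM.
have Ed : ((q * M.+1 + r).*2 %/ M.+1 = q.*2)%N.
  rewrite -muln2 mulnDl mulnAC divnMDl // divn_small; lia.
have Eq : ((q * M.+1 + r) %/ M = q)%N.
  have -> : (q * M.+1 + r = q * M + (q + r))%N by lia.
  rewrite divnMDl ?divn_small; lia.
have Er : ((q * M.+1 + r) %% M = q + r)%N.
  have -> : (q * M.+1 + r = q * M + (q + r))%N by lia.
  by rewrite modnMDl modn_small.
rewrite /coef_c Ed Eq Er odd_double /=.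
case: eqP => [s0|s_neq0].
  have [-> ->] : q = 0%N /\ r = 0%N by nia.
  by rewrite bin0.
(* For q + r > M/2 the definition gives 0, and so does 'C(M/2 - r, q). *)
case: leqP => [le_h|lt_h]; last by rewrite bin_small ?mulr0 //; lia.
case: q {Ed Eq Er} => [|q] in lt_qrM s_neq0 le_h *.
  by rewrite /= (_ : (r == 0)%N = false) ?muln0 ?mulr0 ?mul0r //; lia.
have -> : (q.+1 + r)%N%:Z - 1 = (r + q)%N%:Z by lia.
have -> : q.+1%:Z - 1 = q%:Z by lia.
have -> : M./2%:Z - (q.+1 + r)%N%:Z + q.+1%:Z = (M./2 - r)%N%:Z by lia.
by rewrite /= mulnC PoszM mulrA.
Qed.

Lemma coef_c_high (M q r : nat) : (M./2 < r <= M)%N ->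
  coef_c M (q * M.+1 + r)
    = - ((-1) ^+ q * ('C(M - r, q) * 'C(r - (M./2).+1 + q, q))%:Z).
Proof.
move=> /andP[lt_hr le_rM].
have Ed : ((q * M.+1 + r).*2 %/ M.+1 = q.*2.+1)%N.
  have -> : ((q * M.+1 + r).*2 = q.*2.+1 * M.+1 + (r.*2 - M.+1))%N by nia.
  rewrite divnMDl // divn_small; lia.
have Eq : ((q * M.+1 + r) %/ M.+1 = q)%N by rewrite divnMDl ?divn_small //; lia.
have Er : ((q * M.+1 + r) %% M.+1 = r)%N by rewrite modnMDl modn_small.
rewrite /coef_c Ed Eq Er /= odd_double /= lt_hr.
rewrite (_ : (_ == 0)%N = false); last by lia.
have -> : M%:Z - r%:Z = (M - r)%N%:Z by lia.
have -> : q%:Z + r%:Z - M./2%:Z - 1 = (r - (M./2).+1 + q)%N%:Z by lia.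
by rewrite /= PoszM exprS; ring.
Qed.

(* The coefficient c_s(M) in terms of the quotient and remainder of s modulo
   M + 1, without the case distinctions of [coef_c]. *)
Definition split_coef (S : comNzRingType) (M s : nat) : S :=
  let q := (s %/ M.+1)%N in let r := (s %% M.+1)%N in
  if (r <= M./2)%N then cheb1_coef S (M./2).+1 r q
  else - cheb2_coef S (M - M./2) (r - (M./2).+1) q.

Section ClosedFormF.
Variables (S : comNzRingType) (A B : S) (M : nat).
Hypothesis M_gt0 : (0 < M)%N.

Local Notation h := (M./2).
Local Notation mon s := (A ^+ (s.*2 %% M.+1) * B ^+ (s.*2 %/ M.+1)).
Local Notation coef := (split_coef S M).

(** This is the quotient-remainder form of the degree bound modulo M + 1. *)
Lemma half_triangle : (M * M.+1 %/ 2 = h * M.+1 + odd M * h.+1)%N.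
Proof.
have EM := odd_double_half M.
have E2 : (M * M.+1 = (h * M.+1 + odd M * h.+1) * 2)%N.
  by case: (odd M) EM => /= EM; nia.
by rewrite [in LHS]E2 mulnK.
Qed.

Lemma coef_cE s : (s <= M * M.+1 %/ 2)%N -> (coef_c M s)%:~R = coef s.
Proof.
rewrite half_triangle => le_s; rewrite /split_coef.
have EM := odd_double_half M.
move: (divn_eq s M.+1) (ltn_pmod s (ltn0Sn M)) => Es.
move: (s %/ _)%N (s %% _)%N Es => q r Es lt_r.
have le_qh : (q <= h)%N by nia.
case: leqP => [le_rh | lt_hr].
  have lt_qr : (q + r < M)%N by nia.
  rewrite Es coef_c_low // /cheb1_coef subSS.
  by rewrite rmorphM rmorphXn rmorphN1 /= pmulrn.
rewrite Es coef_c_high ?lt_hr // /cheb2_coef.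
have -> : (M - h - (r - h.+1).+1 = M - r)%N by lia.
by rewrite rmorphN rmorphM rmorphXn rmorphN1 /= pmulrn.
Qed.

(** The degree bound falls inside the block of quotient h = M/2. Past it the upper index of the
    first binomial is below h, so the sum may be extended to h + 1 full blocks of length M + 1. *)
Lemma split_coef_big s : (M * M.+1 %/ 2 < s < h.+1 * M.+1)%N -> coef s = 0.
Proof.
rewrite half_triangle /split_coef => /andP[lt_s gt_s].
have EM := odd_double_half M.
move: (divn_eq s M.+1) (ltn_pmod s (ltn0Sn M)) => Es.
move: (s %/ _)%N (s %% _)%N Es => q r Es lt_r.
have eq_qh : q = h by nia.
have rP : (0 < r)%N && (odd M ==> (h.+1 < r)%N) by case: (odd M) in EM lt_s *; nia.
by case: leqP => ?; rewrite /cheb1_coef /cheb2_coef bin_small ?(mulr0, oppr0) //;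
  case: (odd M) in rP EM *; lia.
Qed.

(** Write s = q (M + 1) + r. Remainders r <= h give monomials A^(2r) B^(2q), which sum to the first
    component. For r = h + 1 + i the doubling carries once, leaving A^(2i) B^(2q+1) with an extra
    [A] when M is even, which gives the second component. *)
Lemma sum_coef_c :
  \sum_(s < (M * M.+1 %/ 2).+1) (coef_c M s)%:~R * mon s =
  (cheb (A ^+ 2) (B ^+ 2) h.+1).1
    - A ^+ (~~ odd M) * B * (cheb (A ^+ 2) (B ^+ 2) (M - h)).2.
Proof.
have EM := odd_double_half M.
have le_s : ((M * M.+1 %/ 2).+1 <= h.+1 * M.+1)%N.
  by rewrite half_triangle; case: (odd M) in EM *; nia.
transitivity (\sum_(0 <= s < h.+1 * M.+1) coef s * mon s).
  rewrite (big_cat_nat _ (n := (M * M.+1 %/ 2).+1)) //= [X in _ + X]big_nat_cond.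
  rewrite [X in _ + X]big1 ?addr0 => [|s /andP[? _]]; last first.
    by rewrite split_coef_big ?mul0r.
  by rewrite big_mkord; apply: eq_bigr => -[s lt_s] _; rewrite coef_cE.
pose G s := coef s * mon s.
have blockE q : \sum_(q * M.+1 <= s < q.+1 * M.+1) G s =
    \sum_(r < h.+1) G (q * M.+1 + r)%N
    + \sum_(i < M - h) G (q * M.+1 + (h.+1 + i))%N.
  rewrite -{1}[(q * _)%N]add0n big_addn mulSn addnK.
  rewrite (big_cat_nat _ (n := h.+1)) //=; last by lia.
  rewrite -{2}[h.+1]add0n big_addn subSS !big_mkord; congr (_ + _).
    by apply: eq_bigr => r _; rewrite addnC.
  by apply: eq_bigr => r _; rewrite addnC [(r + _)%N]addnC.
rewrite big_nat_mul big_mkord; under eq_bigr => q _ do rewrite blockE.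
have [/(_ h.+1 (leqnn _)) -> _] := cheb_closed_form S (A ^+ 2) (B ^+ 2) h.
have [_ /(_ h.+1) ->] := cheb_closed_form S (A ^+ 2) (B ^+ 2) (M - h); last by lia.
rewrite big_split /= mulr_sumr -sumrN; congr (_ + _).
  rewrite exchange_big; apply: eq_bigr => -[r lt_r] _ /=.
  apply: eq_bigr => -[q lt_q] _ /=.
  have Eq : ((q * M.+1 + r) %/ M.+1 = q)%N by rewrite divnMDl ?divn_small //; lia.
  have Er : ((q * M.+1 + r) %% M.+1 = r)%N by rewrite modnMDl modn_small //; lia.
  rewrite /G /split_coef Eq Er -ltnS lt_r -mulrA; congr (_ * _).
  have E2 : ((q * M.+1 + r).*2 = q.*2 * M.+1 + r.*2)%N by nia.
  rewrite E2 divnMDl // modnMDl divn_small ?modn_small ?addn0; try lia.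
  by rewrite -!mul2n !exprM.
rewrite exchange_big; apply: eq_bigr => -[i lt_i] _ /=.
rewrite mulr_sumr -sumrN; apply: eq_bigr => -[q lt_q] _ /=.
have Eq : ((q * M.+1 + (h.+1 + i)) %/ M.+1 = q)%N.
  by rewrite divnMDl ?divn_small //; lia.
have Er : ((q * M.+1 + (h.+1 + i)) %% M.+1 = h.+1 + i)%N.
  by rewrite modnMDl modn_small //; lia.
rewrite /G /split_coef Eq Er leqNgt ltnS leq_addr /= addKn.
have E2 : ((q * M.+1 + (h.+1 + i)).*2 = q.*2.+1 * M.+1 + (~~ odd M + i.*2))%N.
  by case: (odd M) in EM *; nia.
rewrite E2 divnMDl // modnMDl divn_small ?modn_small ?addn0.
- by rewrite exprS exprD -!mul2n !exprM; ring.
- by case: (odd M) in EM *; lia.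
- by case: (odd M) in EM *; lia.
Qed.

End ClosedFormF.

(** Writing 2s = d (M + 1) + e turns a^e b^d t^(2s) into (a t)^e (b t^(M+1))^d. *)
Lemma comp_poly_f (R : comNzRingType) (M : nat) (a b : R) : (0 < M)%N ->
  poly_f M a b \Po 'X^2 =
  (cheb ((a *: 'X) ^+ 2) ((b *: 'X^(M.+1)) ^+ 2) (M./2).+1).1
    - (a *: 'X) ^+ (~~ odd M) * (b *: 'X^(M.+1))
      * (cheb ((a *: 'X) ^+ 2) ((b *: 'X^(M.+1)) ^+ 2) (M - M./2)).2.
Proof.
move=> M_gt0; rewrite -sum_coef_c // /poly_f poly_def raddf_sum.
apply: eq_bigr => s _ /=.
rewrite linearZ /= rmorphXn /= comp_polyX -exprM mul2n.
have := divn_eq s.*2 M.+1.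
move: (s.*2 %/ _)%N (s.*2 %% _)%N => d e ->.
rewrite -!mul_polyC !exprMn !rmorphM !rmorphXn /= rmorph_int.
rewrite exprD [(d * _)%N]mulnC exprM.
by ring.
Qed.

(** * Power series and the Hadamard square *)

Section Truncation.
Variable R : comUnitRingType.
Implicit Types (s : fps R) (p q : {poly R}).

(** The quotient by X^(L+1) is a commutative ring, so the reflection lemmas apply to truncated
    series. *)
Definition trunc (L : nat) s : {poly %/ ('X^(L.+1) : {poly R})} :=
  in_qpoly 'X^(L.+1) (\poly_(i < L.+1) s i).
Arguments trunc L s : clear implicits.


Lemma in_qpolyXnP L p q :
  in_qpoly 'X^(L.+1) p = in_qpoly 'X^(L.+1) q
    <-> (forall i, (i <= L)%N -> p`_i = q`_i).
Proof.
have modE r : Pdiv.CommonRing.rmodp r (mk_monic 'X^(L.+1)) = take_poly L.+1 r.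
  by rewrite mk_monic_Xn Pdiv.RingMonic.take_poly_rmodp.
split=> [/(congr1 (fun r : {poly %/ _} => r : {poly R})) /= | eq_pq].
  rewrite !modE => /polyP eq_pq i le_iL.
  by have := eq_pq i; rewrite !coef_take_poly ltnS le_iL.
apply: val_inj; rewrite /= !modE; apply/polyP=> i; rewrite !coef_take_poly ltnS.
by case: leqP => // /eq_pq.
Qed.

Lemma truncP L s s' :
  trunc L s = trunc L s' <-> (forall i, (i <= L)%N -> s i = s' i).
Proof.
split=> [/in_qpolyXnP eq_ss' i le_iL | eq_ss'].
  by have := eq_ss' i le_iL; rewrite !coef_poly ltnS le_iL.
by apply/in_qpolyXnP=> i le_iL; rewrite !coef_poly ltnS le_iL eq_ss'.
Qed.

Lemma trunc_poly L p : trunc L (fps_of_poly p) = in_qpoly 'X^(L.+1) p.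
Proof. by apply/in_qpolyXnP=> i le_iL; rewrite coef_poly ltnS le_iL. Qed.

Lemma trunc_mul L s s' : trunc L (fps_mul s s') = trunc L s * trunc L s'.
Proof.
rewrite /trunc -rmorphM /=; apply/in_qpolyXnP=> i le_iL.
rewrite coef_poly ltnS le_iL coefM; apply: eq_bigr => -[j lt_ji] _ /=.
by rewrite !coef_poly !ltnS (leq_trans _ le_iL) // (leq_trans _ le_iL) ?leq_subr.
Qed.

(** Division becomes a product equation in every quotient ring, where p is invertible with inverse
    the truncated reciprocal series. *)
Lemma fps_divP s p s' : p`_0 \is a GRing.unit ->
  (forall L, in_qpoly 'X^(L.+1) p * trunc L s = trunc L s')
    <-> s =1 fps_div s' (fps_of_poly p).
Proof.
move=> /(fps_mulV (A := fps_of_poly p)) invp.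
have invL L : trunc L (fps_inv (fps_of_poly p)) * in_qpoly 'X^(L.+1) p = 1.
  transitivity (trunc L (fps_of_poly 1)); last by rewrite trunc_poly rmorph1.
  by rewrite -trunc_poly -trunc_mul; apply/truncP.
split=> [eq_s n | eq_s L].
  suff /truncP/(_ n (leqnn n)) :
    trunc n s = trunc n (fps_div s' (fps_of_poly p)) by [].
  by rewrite trunc_mul -eq_s mulrC mulrA invL mul1r.
have -> : trunc L s = trunc L (fps_div s' (fps_of_poly p)) by apply/truncP.
by rewrite trunc_mul mulrCA [_ * trunc L (fps_inv _)]mulrC invL mulr1.
Qed.

Lemma trunc_shift L (N : nat) (a b c : R) s s1 s2 :
  (forall i, s i = c * (i == 0%N)%:R + a * (if i is j.+1 then s1 j else 0)
                   + b * (if (N <= i)%N then s2 (i - N)%N else 0)) ->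
  trunc L s = in_qpoly 'X^(L.+1) c%:P + in_qpoly 'X^(L.+1) (a *: 'X) * trunc L s1
              + in_qpoly 'X^(L.+1) (b *: 'X^N) * trunc L s2.
Proof.
move=> sE; rewrite /trunc -!rmorphM -!rmorphD /=.
apply/in_qpolyXnP=> i le_iL.
rewrite coef_poly ltnS le_iL sE !coefD coefC -!scalerAl !coefZ coefXM coefXnM.
rewrite !coef_poly !ltnS (leq_trans (leq_subr _ _) le_iL).
congr (_ + _ + _ * _); first by case: eqP; rewrite ?mulr1 ?mulr0.
  by case: i le_iL {sE} => //= i lt_iL; rewrite ltnW.
by case: leqP.
Qed.

End Truncation.

(** * The diagonal series of 1/p_N and their recurrences *)

Section Recurrence.
Variables (R : comUnitRingType) (N : nat) (a b : R).
Hypothesis N_gt0 : (0 < N)%N.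

Definition recip_p : fps R :=
  fps_div (fps_of_poly 1) (fps_of_poly (poly_p N a b)).
Local Notation u := recip_p.

Lemma recip_pE n : u n = (n == 0%N)%:R + a * (if n is j.+1 then u j else 0)
  + b * (if (N <= n)%N then u (n - N)%N else 0).
Proof.
have unit_p : (poly_p N a b)`_0 \is a GRing.unit by rewrite poly_p0 ?unitr1.
have := (fps_divP _ u _ (fps_of_poly 1) unit_p).2 (frefl _) n.
rewrite trunc_poly /trunc -rmorphM /= => /in_qpolyXnP/(_ n (leqnn n)).
rewrite /poly_p !mulrBl mul1r -!scalerAl !coefB !coefZ coefXM coefXnM coef1.
rewrite !coef_poly !ltnS leqnn leq_subr => /eqP.
rewrite !subr_eq => /eqP ->; rewrite addrAC; congr (_ + _ * _ + _ * _).
  by case: n => //= n; rewrite leqnSn.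
by case: leqP.
Qed.

Lemma recip_p0 : u 0%N = 1.
Proof. by rewrite recip_pE leqNgt N_gt0 /= !mulr0 !addr0. Qed.

Lemma recip_pS n : u n.+1 = a * u n
  + b * (if (N <= n.+1)%N then u (n.+1 - N)%N else 0).
Proof. by rewrite recip_pE /= add0r. Qed.

(* The coefficients of \sum_n u n * u (n + k) t^(2n + k). *)
Definition diag (k : nat) : fps R := fun i =>
  if (k <= i)%N && ~~ odd (i - k) then u (i - k)./2 * u (i + k)./2 else 0.

Lemma diag0E :
  diag 0 =1 fps_sqrt_var (hadamard u u).
Proof.
move=> i; rewrite /diag /fps_sqrt_var /hadamard subn0 addn0.
by case: (odd i).
Qed.

Lemma diag_out k i : (i < k)%N || odd (i + k) -> diag k i = 0.
Proof. by move=> ki; rewrite /diag ifF //; lia. Qed.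

Lemma diag_in k j : diag k (j.*2 + k)%N = u j * u (j + k)%N.
Proof.
rewrite /diag leq_addl addnK odd_double /= doubleK.
by congr (_ * u _); lia.
Qed.

Lemma diagE k i j l : i = (j + l)%N -> l = (j + k)%N -> diag k i = u j * u l.
Proof. by move=> -> ->; rewrite -diag_in; congr diag; lia. Qed.

(** Expand the factor of larger index in u_j u_(j+k), which is positive as k > 0. The index gaps
    become k - 1 and, since j + k - N <= j, N - k: the second term is reflected. *)
Lemma diag_rec k i : (0 < k <= N)%N ->
  diag k i = 0 * (i == 0%N)%:R + a * (if i is j.+1 then diag k.-1 j else 0)
             + b * (if (N <= i)%N then diag (N - k) (i - N)%N else 0).
Proof.
move=> /andP[k_gt0 le_kN]; rewrite mul0r add0r.
have [out | ] := boolP ((i < k)%N || odd (i + k)).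
  rewrite diag_out //.
  case: i out => [|i] out; first by rewrite leqNgt N_gt0 !mulr0 addr0.
  rewrite diag_out; last by lia.
  by case: leqP => ?; rewrite ?(mulr0, addr0) // diag_out ?mulr0 ?addr0 //; lia.
rewrite negb_or -leqNgt => /andP[le_ki ev].
have [j [l [Ei El]]] : exists j l, i = (j + l.+1)%N /\ l.+1 = (j + k)%N.
  by exists (i - k)./2, ((i + k)./2).-1; lia.
rewrite (diagE k i j l.+1) // recip_pS mulrDr !(mulrCA (u j)).
rewrite {1}Ei addnS (diagE k.-1 (j + l)%N j l) //; last by lia.
congr (_ + _ * _).
case: (leqP N l.+1) => [le_Nl | lt_lN].
  rewrite ifT; last by lia.
  by rewrite mulrC (diagE _ _ (l.+1 - N)%N j) //; lia.
by rewrite mulr0; case: leqP => // ?; rewrite diag_out //; lia.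
Qed.

(** Expanding one factor of u_j^2 gives gaps 1 and N; the constant 1 is u_0^2. *)
Lemma diag0_rec i :
  diag 0 i = 1 * (i == 0%N)%:R + a * (if i is j.+1 then diag 1 j else 0)
             + b * (if (N <= i)%N then diag N (i - N)%N else 0).
Proof.
rewrite mul1r; case: i => [|i].
  by rewrite (diagE _ _ 0%N 0%N) // leqNgt N_gt0 /= recip_p0 !mulr0 !addr0 mulr1.
rewrite add0r.
have [odd_i | even_i] := boolP (odd i.+1).
  rewrite (diag_out 0) ?(diag_out 1); [ | lia | lia].
  by case: leqP => ?; rewrite ?(mulr0, addr0) // diag_out ?mulr0 ?addr0 //; lia.
have [j Ei] : exists j, i.+1 = (j.+1 + j.+1)%N by exists (i.+1./2).-1; lia.
rewrite (diagE _ _ j.+1 j.+1) // ?addn0 // (diagE 1 i j j.+1) //; try lia.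
rewrite {2}recip_pS mulrDr !(mulrCA (u j.+1)) [u j.+1 * u j]mulrC.
congr (_ + _ * _).
case: (leqP N j.+1) => [le_Nj | lt_jN].
  rewrite ifT; last by lia.
  by rewrite mulrC (diagE _ _ (j.+1 - N)%N j.+1) //; lia.
by rewrite mulr0; case: leqP => // ?; rewrite diag_out //; lia.
Qed.

Lemma trunc_diag_rec L k : (0 < k <= N)%N ->
  trunc R L (diag k) = in_qpoly 'X^(L.+1) (a *: 'X) * trunc R L (diag k.-1)
    + in_qpoly 'X^(L.+1) (b *: 'X^N) * trunc R L (diag (N - k)).
Proof.
move=> kP; rewrite (trunc_shift _ _ N a b 0 _ (diag k.-1) (diag (N - k))).
  by rewrite polyC0 rmorph0 add0r.
by move=> i; exact: diag_rec.
Qed.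

Lemma trunc_diag0_rec L :
  trunc R L (diag 0) = 1 + in_qpoly 'X^(L.+1) (a *: 'X) * trunc R L (diag 1)
    + in_qpoly 'X^(L.+1) (b *: 'X^N) * trunc R L (diag N).
Proof.
rewrite (trunc_shift _ _ N a b 1 _ (diag 1) (diag N)); last exact: diag0_rec.
by rewrite rmorph1.
Qed.

End Recurrence.

(** * Assembly of the identity for the Hadamard square *)

Lemma rmorph_cheb (S T : comNzRingType) (f : {rmorphism S -> T}) x y n :
  cheb (f x) (f y) n = (f (cheb x y n).1, f (cheb x y n).2).
Proof.
elim: n => [|n IHn]; first by rewrite /= rmorph1 rmorph0.
by rewrite /= IHn !(rmorphB, rmorphD, rmorphM).
Qed.

Lemma comp_poly_p (R : comNzRingType) N (a b : R) :
  poly_p N a b \Po - 'X = 1 + a *: 'X - (-1) ^+ N * (b *: 'X^N).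
Proof.
rewrite /poly_p !comp_polyB -[1]polyC1 comp_polyC !comp_polyZ comp_polyX.
by rewrite comp_Xn_poly (exprNn 'X) -!mul_polyC; ring.
Qed.

Lemma hadamard_square_div (R : idomainType) (N : nat) (a b : R) :
    (1 < N)%N -> a != 0 ->
  let p := poly_p N a b in
  fps_sqrt_var (hadamard (recip_p R N a b) (recip_p R N a b)) =1
    fps_div (fps_of_poly (poly_f N.-1 a b \Po 'X^2))
            (fps_of_poly (p * (p \Po - 'X) * (poly_f N.-1 a (- b) \Po 'X^2))).
Proof.
move=> N_gt1 a_neq0 p; have N_gt0 := ltnW N_gt1.
apply/fps_divP=> [|L]; first by rewrite denominator0 ?unitr1.
have -> : trunc R L (fps_sqrt_var (hadamard (recip_p R N a b) (recip_p R N a b)))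
    = trunc R L (diag R N a b 0).
  by apply/truncP=> i _; rewrite diag0E.
rewrite trunc_poly; set m := N./2.
set D := p * _ * _; set f := poly_f _ _ _ \Po _.
suff key K : in_qpoly 'X^(K.+1) ((a *: 'X) ^+ m)
      * (in_qpoly 'X^(K.+1) D * trunc R K (diag R N a b 0))
    = in_qpoly 'X^(K.+1) ((a *: 'X) ^+ m) * in_qpoly 'X^(K.+1) f.
  (* Cancelling (a X)^m costs m coefficients, hence the precision L + m; a^m is cancelled in the
     domain R. *)
  have := key (L + m)%N; rewrite /trunc -!(in_qpolyM _ D) -!in_qpolyM => /in_qpolyXnP eqK.
  apply/in_qpolyXnP=> i le_iL.
  have := eqK (i + m)%N; rewrite leq_add2r => /(_ le_iL).
  rewrite exprZn -!scalerAl !coefZ !coefXnM ltnNge leq_addl addnK /=.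
  move/(mulfI (expf_neq0 m a_neq0)) => <-.
  rewrite [LHS]coefM [RHS]coefM; apply: eq_bigr => -[j lt_ji] _ /=; congr (_ * _).
  by rewrite !coef_poly !ltnS !(leq_trans (leq_subr _ _)) // (leq_trans le_iL) ?leq_addr.
have [A AE] : exists A, A = a *: 'X :> {poly R} by eexists.
have [B BE] : exists B, B = b *: 'X^N :> {poly R} by eexists.
have g_rec := trunc_diag_rec _ N a b N_gt0 K.
have g0 := trunc_diag0_rec _ N a b N_gt0 K.
(* E and F involve B only through B^2, so replacing b by -b only flips the sign of the second
   term. *)
have [E [F [EE EF fE fE']]] : exists E F,
    [/\ E = (cheb (A ^+ 2) (B ^+ 2) (N.-1)./2.+1).1,
        F = (cheb (A ^+ 2) (B ^+ 2) (N.-1 - (N.-1)./2)).2,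
        f = E - A ^+ odd N * B * F
      & poly_f N.-1 a (- b) \Po 'X^2 = E + A ^+ odd N * B * F].
  do 2!eexists; split; [reflexivity | reflexivity | |].
  - by rewrite /f comp_poly_f; [rewrite prednK // -oddS prednK // -AE -BE | lia].
  - rewrite comp_poly_f; last by lia.
    rewrite prednK // -oddS prednK // scaleNr -AE -BE sqrrN.
    by rewrite mulrN mulNr opprK.
rewrite /D fE' fE /p comp_poly_p /poly_p.
rewrite -AE -BE in g_rec g0 *.
pose phi : {rmorphism {poly R} -> {poly %/ 'X^(K.+1)}} := in_qpoly 'X^(K.+1).
rewrite -![in_qpoly _ _]/(phi _) in g_rec g0 *.
have EN := odd_double_half N; rewrite -/m in EN.
have cheb_phi1 n :
    (cheb (phi A ^+ 2) (phi B ^+ 2) n).1 = phi (cheb (A ^+ 2) (B ^+ 2) n).1.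
  by rewrite -!(rmorphXn phi) (rmorph_cheb _ _ phi).
have cheb_phi2 n :
    (cheb (phi A ^+ 2) (phi B ^+ 2) n).2 = phi (cheb (A ^+ 2) (B ^+ 2) n).2.
  by rewrite -!(rmorphXn phi) (rmorph_cheb _ _ phi).
pose g k := trunc R K (diag R N a b k).
have m_gt0 : (0 < m)%N by lia.
(* The parity of N fixes the sign in p_N(-t), hence which factored form p_N(t) p_N(-t) takes and
   which reflection lemma applies. *)
rewrite -signr_odd.
case: (odd N) EN fE fE' => /= EN _ _.
  have := reflection_odd _ (phi A) (phi B) m g m_gt0.
  rewrite -[m.*2.+1]add1n EN !cheb_phi1 !cheb_phi2.
  have -> : m.+1 = (N.-1)./2.+1 by lia.
  have -> : (cheb (A ^+ 2) (B ^+ 2) m).2 = F by rewrite EF; congr (cheb _ _ _).2; lia.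
  rewrite -EE => /(_ (fun k => g_rec k) g0) H.
  rewrite !(rmorphM, rmorphB, rmorphD, rmorphN, rmorph1, rmorphXn) /=.
  by rewrite !expr1 -[RHS]H /g; ring.
have := reflection_even _ (phi A) (phi B) m g m_gt0.
rewrite -[m.*2]add0n EN !cheb_phi1 !cheb_phi2.
have -> : (cheb (A ^+ 2) (B ^+ 2) m).1 = E by rewrite EE; congr (cheb _ _ _).1; lia.
have -> : (cheb (A ^+ 2) (B ^+ 2) m).2 = F by rewrite EF; congr (cheb _ _ _).2; lia.
move=> /(_ (fun k => g_rec k) g0) H.
rewrite !(rmorphM, rmorphB, rmorphD, rmorphN, rmorph1, rmorphXn) /=.
by rewrite ?expr0 ?mul1r -[RHS]H /g; ring.
Qed.

(* Both sides are series in t = sqrt x, so that x is t^2. *)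
Theorem theorem1p7 (k : idomainType) (N : nat) (hN : (2 <= N)%N) :
  let a : {mpoly k[2]} := 'X_ord0 in
  let b : {mpoly k[2]} := 'X_ord_max in
  let p := poly_p N a b in
  fps_sqrt_var
    (hadamard (fps_div (fps_of_poly 1) (fps_of_poly p))
              (fps_div (fps_of_poly 1) (fps_of_poly p)))
  =1 fps_div
       (fps_of_poly (poly_f N.-1 a b \Po 'X^2))
       (fps_of_poly
          (p * (p \Po - 'X) * (poly_f N.-1 a (- b) \Po 'X^2))).
Proof.
move=> a b p; apply: hadamard_square_div => //.
apply/eqP=> /(congr1 (fun q : {mpoly k[2]} => q@_U_(ord0))).
by rewrite mcoeffX eqxx mcoeff0; apply/eqP/oner_neq0.
Qed.
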